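(* For every integer $\omega\ge 8$ there exist a series-parallel graph $G$ and a linear ordering $\tau$ of its vertices such that, for every integer $k$ with $0\le k<\lfloor\omega/2\rfloor-3$, the graph story $(G,\omega,k,\tau)$ is not realizable.
   Context: A graph story is a tuple $\mathcal{S}=(G,\omega,k,\tau)$ where $G=(V,E)$ is an $n$-vertex graph, $\omega\le n$ is a positive integer, $k\ge 0$ is an integer, and $\tau=\langle v_1,\dots,v_n\rangle$ is a linear ordering of $V$. For $1\le i\le n$, $G_i$ is the subgraph of $G$ induced by $\{v_j:\max\{1,i-\omega+1\}\le j\le i\}$. Throughout, every edge $(v_i,v_j)$ of $G$ satisfies $|i-j|<\omega$. A drawing maps vertices to distinct points of the plane and edges to Jordan arcs between their end-vertices; it is planar if no two edges intersect except at common endpoints. A realization of $\mathcal{S}$ on a set $P$ of $\omega+k$ points is a sequence $\langle\Gamma_1,\dots,\Gamma_n\rangle$ such that (R1) each $\Gamma_i$ is a planar drawing of $G_i$ with distinct vertices mapped to distinct points of $P$, and (R2) for $2\le i\le n$ the restrictions of $\Gamma_{i-1}$ and $\Gamma_i$ to $G_{i-1}\cap G_i$ are identical; $\mathcal{S}$ is realizable if it has a realization on some set of $\omega+k$ points. *)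

(* Defs.v *)
From HB Require Import structures.
From mathcomp Require Import all_boot all_order all_algebra.
From mathcomp Require Import all_classical all_reals all_analysis.

Set Implicit Arguments.
Unset Strict Implicit.
Unset Printing Implicit Defensive.

Import Order.TTheory GRing.Theory Num.Theory.
Import numFieldNormedType.Exports.

Local Open Scope classical_set_scope.
Local Open Scope ring_scope.

(* Finite simple graphs; an edge is the 2-element set of its end-vertices. *)
Record graph := Graph {
  vertex :> finType;
  edges : {set {set vertex}};
  edges_card2 : forall e, e \in edges -> #|e| = 2%N
}.

(* [ttsp V E s t]: the graph (V, E) is a two-terminal series-parallel graph
   with terminals s and t.  Gluing two graphs along terminals is expressed
   inside the ambient vertex type T, as the union of two graphs sharing exactly
   the identified terminals.  The last premise of [ttsp_parallel] keeps the
   composition simple: the two parts may not both contain the edge st. *)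
Inductive ttsp (T : finType) :
    {set T} -> {set {set T}} -> T -> T -> Prop :=
| ttsp_edge (s t : T) :
    s != t -> ttsp [set s; t]%SET [set [set s; t]]%SET s t
| ttsp_series (V1 : {set T}) (E1 : {set {set T}})
    (V2 : {set T}) (E2 : {set {set T}}) (s m t : T) :
    ttsp V1 E1 s m -> ttsp V2 E2 m t ->
    (V1 :&: V2 = [set m])%SET ->
    ttsp (V1 :|: V2)%SET (E1 :|: E2)%SET s t
| ttsp_parallel (V1 : {set T}) (E1 : {set {set T}})
    (V2 : {set T}) (E2 : {set {set T}}) (s t : T) :
    ttsp V1 E1 s t -> ttsp V2 E2 s t ->
    (V1 :&: V2 = [set s; t])%SET -> [disjoint E1 & E2]%B ->
    ttsp (V1 :|: V2)%SET (E1 :|: E2)%SET s t.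

Definition series_parallel (G : graph) : Prop :=
  exists s t : G, ttsp [set: G]%SET (edges G) s t.

(* The tuple (G, omega, k, tau); the conditions it has to satisfy are
   in [is_graph_story]. *)
Record graph_story := GraphStory {
  story_graph : graph;
  story_window : nat;
  story_extra : nat;
  story_order : #|story_graph|.-tuple story_graph
}.

(* The index j in 1..n such that x = v_j. *)
Definition story_rank (S : graph_story) (x : story_graph S) : nat :=
  (index x (story_order S)).+1.

(* Since x and y range over both orders of the end-vertices of an edge,
   the last condition says |i - j| < omega for every edge (v_i, v_j). *)
Definition is_graph_story (S : graph_story) : Prop :=
  [/\ (0 < story_window S <= #|story_graph S|)%N,
      uniq (story_order S)
    & forall x y : story_graph S, [set x; y]%SET \in edges (story_graph S) ->
        (story_rank x < story_rank y + story_window S)%N].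

(* The vertices and the edges of G_i, for 1 <= i <= n.  The truncated
   subtraction is harmless because of the maximum with 1. *)
Definition window_vertices (S : graph_story) (i : nat) :
    {set story_graph S} :=
  [set x | (maxn 1 (i.+1 - story_window S) <= story_rank x <= i)%N]%SET.

Definition window_edges (S : graph_story) (i : nat) :
    {set {set story_graph S}} :=
  [set e in edges (story_graph S) | e \subset window_vertices S i]%SET.

Section Drawings.
Variable R : realType.

Definition jordan_arc (p q : R * R) (A : set (R * R)) : Prop :=
  exists gamma : R -> R * R,
    [/\ {within `[0, 1], continuous gamma},
        {in `[0, 1] &, injective gamma},
        gamma 0 = p, gamma 1 = q & A = gamma @` `[0, 1]].

(* The values are only meaningful on the vertices and edges of the drawn
   subgraph. *)
Record drawing (V : finType) := Drawing {
  point_of : V -> R * R;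
  arc_of : {set V} -> set (R * R)
}.

Definition is_drawing (V : finType) (W : {set V}) (F : {set {set V}})
    (D : drawing V) : Prop :=
  {in W &, injective (point_of D)} /\
  forall x y : V, [set x; y]%SET \in F ->
    jordan_arc (point_of D x) (point_of D y) (arc_of D [set x; y]%SET).

(* Only pairs of edges are constrained.  An edge avoids every vertex with an
   incident edge other than its own end-vertices, but passing through an
   isolated vertex is not excluded; this makes [realizable] more permissive,
   hence non-realizability stronger. *)
Definition planar (V : finType) (F : {set {set V}}) (D : drawing V) : Prop :=
  forall e f : {set V}, e \in F -> f \in F -> e != f ->
  forall p : R * R, arc_of D e p -> arc_of D f p ->
  exists2 v : V, v \in (e :&: f)%SET & p = point_of D v.

Definition realization (S : graph_story) (P : set (R * R))
    (Gamma : nat -> drawing (story_graph S)) : Prop :=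
  (forall i, (1 <= i <= #|story_graph S|)%N ->
     [/\ is_drawing (window_vertices S i) (window_edges S i) (Gamma i),
         planar (window_edges S i) (Gamma i)
       & forall x, x \in window_vertices S i -> P (point_of (Gamma i) x)]) /\
  (forall i, (2 <= i <= #|story_graph S|)%N ->
     (forall x, x \in (window_vertices S i.-1 :&: window_vertices S i)%SET ->
        point_of (Gamma i.-1) x = point_of (Gamma i) x) /\
     (forall e, e \in (window_edges S i.-1 :&: window_edges S i)%SET ->
        arc_of (Gamma i.-1) e = arc_of (Gamma i) e)).

Definition realizable (S : graph_story) : Prop :=
  exists2 P : set (R * R), (P #= `I_(story_window S + story_extra S))%card
    & exists Gamma : nat -> drawing (story_graph S), realization P Gamma.

End Drawings.

(* Main.v *)
(* By van Kampen's argument, in any nine continua joining three points to three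
   points of the plane, two continua without a common end meet.  Cut each continuum
   into short steps and count mod 2 the crossings over all pairs of edges without a
   common end: this number is odd wherever the points are, whereas it would vanish
   if those pairs were disjoint.

   Let r = omega/2 - 1.  The graph is the union of r triangles (a, x_i, o_i), of
   the edges (b, x_i) and of a path starting at a; the order is the o_i, the x_i,
   b, a, and then the path.  While a, b and all the x_i are alive, the o_i are
   replaced by omega - r - 2 vertices of the path.  If three of those vertices
   reused the points of o_i, o_j and o_l, then the path, together with the former
   arcs from these points to x_i, x_j and x_l, would act as the third vertex of a
   K_{3,3} with sides {a, b, path} and {x_i, x_j, x_l}.  Hence at most two points are
   reused, and the other vertices of the path require omega - r - 4 points besides
   the 2r + 2 points of the a, b, x_i, o_i, which forces k >= r - 2. *)

Require Import Defs.
From HB Require Import structures.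
From mathcomp Require Import all_boot all_order all_algebra.
From mathcomp Require Import all_classical all_reals all_analysis.
From mathcomp Require Import lra zify.
From Stdlib Require Import Btauto.

Set Implicit Arguments.
Unset Strict Implicit.
Unset Printing Implicit Defensive.

Import Order.TTheory GRing.Theory Num.Theory.
Import numFieldNormedType.Exports.

(** * Crossing parity of walks *)

Section Crossing.
Variables (T : Type) (A B : T -> T -> bool).

Fixpoint walk_sum (F : T -> T -> bool) (p : T) (s : seq T) : bool :=
  if s is q :: s' then F p q (+) walk_sum F q s' else false.

Lemma eq_walk_sum F G p s :
  (forall x y, F x y = G x y) -> walk_sum F p s = walk_sum G p s.
Proof. by move=> FG; elim: s p => //= q s IHs p; rewrite FG IHs. Qed.

Lemma walk_sumD F G p s :
  walk_sum (fun x y => F x y (+) G x y) p s = walk_sum F p s (+) walk_sum G p s.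
Proof. by elim: s p => //= q s IHs p; rewrite IHs addbACA. Qed.

Lemma walk_sum_telescope f p s :
  walk_sum (fun x y => f x (+) f y) p s = f p (+) f (last p s).
Proof.
elim: s p => [|q s IHs] p /=; first by rewrite addbb.
by rewrite IHs addbA -(addbA (f p)) addbb addbF.
Qed.

(* Read [A q p] as "q is on the left of p" and [B q p] as "q is below p".  A step is
   drawn as a horizontal segment followed by a vertical one, and the walk through
   [q, q'] is shifted infinitesimally up and to the right. *)
Definition step_cross p p' q q' :=
  ((A q' p (+) A q' p') && (B q p (+) B q' p)) (+)
  ((B q p (+) B q p') && (A q p' (+) A q' p')).

Definition cross p s q s' :=
  walk_sum (fun x x' => walk_sum (step_cross x x') q s') p s.

(* Crossings of a walk with the horizontal rays from z. *)
Definition ray_left q s z :=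
  walk_sum (fun y y' => A y' z && (B y z (+) B y' z)) q s.
Definition ray_right p s z :=
  walk_sum (fun x x' => A z x' && (B z x (+) B z x')) p s.

(* In particular two closed walks cross an even number of times. *)
Lemma crossE p s q s' :
  cross p s q s' = (ray_left q s' p (+) ray_left q s' (last p s)) (+)
                   (ray_right p s q (+) ray_right p s (last q s')).
Proof.
(* The crossing bit of two steps is the change from [x] to [x'] of the left-ray bit of the step
   [y, y'], plus the change from [y] to [y'] of the right-ray bit of the step [x, x']. Each change
   telescopes along its walk. *)
have stepE x x' y y' : step_cross x x' y y' =
    ((A y' x && (B y x (+) B y' x)) (+) (A y' x' && (B y x' (+) B y' x'))) (+)
    ((A y x' && (B y x (+) B y x')) (+) (A y' x' && (B y' x (+) B y' x'))).
  rewrite /step_cross.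
  by case: (A y' x); case: (A y' x'); case: (A y x'); case: (B y x);
     case: (B y' x); case: (B y x'); case: (B y' x').
rewrite /cross -(walk_sum_telescope (ray_left q s')).
rewrite /(ray_right p) -!walk_sumD; apply: eq_walk_sum => x x'.
rewrite (eq_walk_sum _ _ (stepE x x')) walk_sumD; congr (_ (+) _).
  by rewrite walk_sumD.
exact: (walk_sum_telescope (fun y => A y x' && (B y x (+) B y x'))).
Qed.

End Crossing.

(** The two rays form the horizontal line through [z], which a walk crosses an odd number of times
    exactly when its ends lie on different sides. *)
Lemma ray_leftDright (T : eqType) (A B : rel T) p s z :
  {in p :: s, forall x, A z x = ~~ A x z} ->
  {in p :: s, forall x, B z x = ~~ B x z} ->
  ray_left A B p s z (+) ray_right A B p s z = B p z (+) B (last p s) z.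
Proof.
elim: s p => [|q s IHs] p nA nB; first by rewrite /= addbb.
rewrite /= addbACA {}IHs; last 2 first.
- by move=> x qsx; apply: nA; rewrite inE qsx orbT.
- by move=> x qsx; apply: nB; rewrite inE qsx orbT.
rewrite nA ?nB ?inE ?eqxx ?orbT //.
by case: (A q z); case: (B p z); case: (B q z); case: (B (last q s) z).
Qed.

Lemma walk_sumP (T : eqType) (F e : rel T) p s :
  path e p s -> walk_sum F p s ->
  exists x y, [/\ x \in p :: s, y \in p :: s, e x y & F x y].
Proof.
elim: s p => //= q s IHs p /andP[epq eqs].
have [Fpq|nFpq] := boolP (F p q); first by exists p, q; rewrite !inE !eqxx !orbT.
rewrite addFb => /(IHs _ eqs)[x [y [xs ys exy Fxy]]].
by exists x, y; split=> //; rewrite inE (xs, ys) orbT.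
Qed.

(** * Odd crossing number of $K_{3,3}$ *)

Section K33.
Variables (T : eqType) (A B : rel T) (u w : nat -> T) (s : nat -> nat -> seq T).
Hypothesis lastE : forall i j, i < 3 -> j < 3 -> last (u i) (s i j) = w j.
Hypothesis w_asym : forall i j, i < 3 -> j < 3 -> i != j -> B (w j) (w i) = ~~ B (w i) (w j).
Hypothesis A_asym : forall j j', j < 3 -> j' < 3 -> j != j' ->
  {in u 1 :: s 1 j, forall x, A (w j') x = ~~ A x (w j')}.
Hypothesis B_asym : forall j j', j < 3 -> j' < 3 -> j != j' ->
  {in u 1 :: s 1 j, forall x, B (w j') x = ~~ B x (w j')}.

Lemma k33_cross_odd :
  exists i i' j j', [/\ [&& i < i', i' < 3, j < 3, j' < 3 & j != j'] &
     cross A B (u i) (s i j) (u i') (s i' j')].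
Proof.
pose c i i' j j' := cross A B (u i) (s i j) (u i') (s i' j').
suff sumT :
   c 0 1 0 1 (+) c 0 1 0 2 (+) c 0 1 1 0 (+) c 0 1 1 2 (+) c 0 1 2 0 (+) c 0 1 2 1
   (+) (c 0 2 0 1 (+) c 0 2 0 2 (+) c 0 2 1 0 (+) c 0 2 1 2 (+) c 0 2 2 0 (+) c 0 2 2 1)
   (+) (c 1 2 0 1 (+) c 1 2 0 2 (+) c 1 2 1 0 (+) c 1 2 1 2 (+) c 1 2 2 0 (+) c 1 2 2 1).
  apply: contrapT => no.
  have c0 i i' j j' : [&& i < i', i' < 3, j < 3, j' < 3 & j != j'] -> c i i' j j' = false.
    by move=> H; apply/negP => cT; apply: no; exists i, i', j, j'.
  by move: sumT; rewrite !c0.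
(* In the sum, only the rays from the [w j'] across the walks from [u 1] do not
   cancel; left and right rays add up to whole lines, so that what remains is the
   number of pairs j != j' such that [w j] is below [w j'], namely 3. *)
pose L i j z := ray_left A B (u i) (s i j) z.
pose R i j z := ray_right A B (u i) (s i j) z.
have cE i i' j j' : [&& i < 3, i' < 3, j < 3 & j' < 3] ->
    c i i' j j' = (L i' j' (u i) (+) L i' j' (w j)) (+) (R i j (u i') (+) R i j (w j')).
  by case/and4P=> *; rewrite /c crossE !lastE.
have RE j j' : [&& j < 3, j' < 3 & j != j'] ->
    R 1 j (w j') = L 1 j (w j') (+) (B (u 1) (w j') (+) B (w j) (w j')).
  case/and3P=> *.
  rewrite -(lastE (i := 1) (j := j)) // -(@ray_leftDright _ A B) ?addKb //.
    exact: A_asym.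
  exact: B_asym.
rewrite !cE // (RE 0 1) // (RE 0 2) // (RE 1 0) // (RE 1 2) // (RE 2 0) // (RE 2 1) //.
rewrite (@w_asym 0 1) // (@w_asym 0 2) // (@w_asym 1 2) //.
have xorE b b' : b (+) b' = xorb b b' by case: b; case: b'.
rewrite !xorE; set rhs := xorb _ _; suff -> : rhs = true by [].
by rewrite /rhs; btauto.
Qed.

End K33.

(** * Disjoint continua and K33 *)

Section Plane.
Variable R : realType.
Implicit Types (p q : R * R) (eps : R).

Local Open Scope classical_set_scope.
Local Open Scope ring_scope.

(** The points reached from [p] by chains of short steps inside [A] form a relatively open and
    closed subset, because any point of [A] closer than [eps] to a reached point is reached as
    well. *)
Lemma connected_chain (V : normedModType R) (A : set V) eps (p q : V) :
  0 < eps -> connected A -> A p -> A q ->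
  exists s : seq V, [/\ last p s = q, path (fun x y => `|x - y| < eps) p s
    & {in s, forall x, A x}].
Proof.
move=> eps0 cA Ap Aq.
pose B := [set z | exists s : seq V, [/\ last p s = z,
  path (fun x y => `|x - y| < eps) p s & {in p :: s, forall x, A x}]].
have BA : B `<=` A.
  by move=> _ [s [<- _ sA]]; apply: sA; rewrite mem_last.
have Bstep x y : B x -> A y -> `|x - y| < eps -> B y.
  move=> [s [sx es sA]] Ay exy; exists (rcons s y); split.
  - by rewrite last_rcons.
  - by rewrite rcons_path es sx.
  - by move=> z; rewrite -rcons_cons mem_rcons inE => /predU1P[-> //|/sA].
suff BE : B = A.
  have: B q by rewrite BE.
  move=> [s [sq es sA]]; exists s; split=> // x xs.
  by apply: sA; rewrite inE xs orbT.
apply: cA.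
- by exists p; exists [::]; split=> // x; rewrite inE => /eqP->.
- exists (\bigcup_(x in B) ball x eps).
    by apply: bigcup_open => x _; exact: ball_open.
  rewrite eqEsubset; split=> [x Bx|y [Ay [x Bx]]].
    by split; [exact: BA|exists x => //; exact: ballxx].
  by rewrite -ball_normE => /(Bstep _ _ Bx Ay).
- exists (closure B); first exact: closed_closure.
  rewrite eqEsubset; split=> [x Bx|y [Ay cBy]].
    by split; [exact: BA|exact: subset_closure].
  have [x [Bx]] := cBy _ (nbhsx_ballx y eps eps0).
  by rewrite -ball_normE /= distrC => /(Bstep _ _ Bx Ay).
Qed.

(** The distances between points of [A] and points of [B] form a compact, hence closed, set that
    misses 0, so it misses a ball around 0. *)
Lemma compact_disjoint_dist (V : normedModType R) (A B : set V) :
  compact A -> compact B -> A `&` B = set0 ->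
  exists2 eps : R, 0 < eps & forall x y, A x -> B y -> eps <= `|x - y|.
Proof.
move=> cA cB AB0.
pose D := (fun z : V * V => `|z.1 - z.2|) @` (A `*` B).
have cD : compact D.
  apply: continuous_compact; last exact: compact_setX.
  apply: continuous_subspaceT => z.
  apply: (@continuous_comp _ _ _ (fun z : V * V => z.1 - z.2) (fun x => `|x|));
    last exact: norm_continuous.
  by apply: cvgB; [exact: cvg_fst|exact: cvg_snd].
have clD : closed D by apply: compact_closed.
have D0 : (~` D) 0.
  move=> [[x y] [/= Ax By]] /eqP; rewrite normr_eq0 subr_eq0 => /eqP xy.
  by have : (A `&` B) x; [split=> //; rewrite xy|rewrite AB0].
have /nbhs_ballP[eps /= eps0 epsD] := open_nbhs_nbhs (conj (closed_openC clD) D0).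
exists eps => // x y Ax By; rewrite leNgt; apply/negP => lt_eps.
have := epsD `|x - y|; rewrite -ball_normE /= sub0r normrN normr_id => /(_ lt_eps).
by apply; exists (x, y).
Qed.

(* Breaking ties lexicographically puts any two distinct points in general position. *)
Definition left_of q p := (q.1 < p.1) || ((q.1 == p.1) && (q.2 < p.2)).
Definition below q p := (q.2 < p.2) || ((q.2 == p.2) && (q.1 < p.1)).

Lemma left_of_asym p q : p != q -> left_of p q = ~~ left_of q p.
Proof.
by case: p q => [a b] [c d]; rewrite xpair_eqE /left_of /=; do 2!case: ltgtP.
Qed.

Lemma below_asym p q : p != q -> below p q = ~~ below q p.
Proof.
by case: p q => [a b] [c d]; rewrite xpair_eqE /below /=; do 2!case: ltgtP.
Qed.

Lemma left_of_between q p p' :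
  left_of q p (+) left_of q p' -> (p.1 <= q.1 <= p'.1) || (p'.1 <= q.1 <= p.1).
Proof. by rewrite /left_of; case: (ltgtP q.1 p.1); case: (ltgtP q.1 p'.1). Qed.

Lemma left_of_between2 p q q' :
  left_of q p (+) left_of q' p -> (q.1 <= p.1 <= q'.1) || (q'.1 <= p.1 <= q.1).
Proof. by rewrite /left_of; case: (ltgtP q.1 p.1); case: (ltgtP q'.1 p.1). Qed.

Lemma below_between p q q' :
  below q p (+) below q' p -> (q.2 <= p.2 <= q'.2) || (q'.2 <= p.2 <= q.2).
Proof.
by rewrite /below; case: (ltgtP q.2 p.2); case: (ltgtP q'.2 p.2).
Qed.

Lemma below_between2 p p' q :
  below q p (+) below q p' -> (p.2 <= q.2 <= p'.2) || (p'.2 <= q.2 <= p.2).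
Proof. by rewrite /below; case: (ltgtP q.2 p.2); case: (ltgtP q.2 p'.2). Qed.

Lemma norm_pair_lt p eps : (`|p| < eps) = (`|p.1| < eps) && (`|p.2| < eps).
Proof. by rewrite prod_normE /= gt_max. Qed.

(** The L-shaped steps cross at [(q'.1, p.2)] or at [(p'.1, q.2)]. In the max norm, this point is
    within [eps] of both [p] and [q]. *)
Lemma step_cross_dist p p' q q' eps :
  `|p - p'| < eps -> `|q - q'| < eps ->
  step_cross left_of below p p' q q' -> `|p - q| < eps + eps.
Proof.
rewrite !norm_pair_lt !ltr_norml /= => /andP[/andP[p1 p2] /andP[p3 p4]].
move=> /andP[/andP[q1 q2] /andP[q3 q4]].
rewrite /step_cross; set b1 := _ && _; set b2 := _ && _ => b12.
have /orP[] : b1 || b2 by case: b1 b2 b12 => [] [].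
  move=> /andP[] /left_of_between/orP[]/andP[h1 h2] /below_between/orP[]/andP[h3 h4];
  by apply/andP; split; apply/andP; split; lra.
move=> /andP[] /below_between2/orP[]/andP[h1 h2] /left_of_between2/orP[]/andP[h3 h4];
  by apply/andP; split; apply/andP; split; lra.
Qed.

Lemma pos_lower_bound (T : finType) (e : T -> R) :
  (forall k, 0 < e k) -> exists2 d, 0 < d & forall k, d <= e k.
Proof.
move=> e0; exists (\big[Num.min/1]_k e k); last by move=> k; exact: bigmin_le.
by apply/bigmin_gtP; split=> // k _; exact: ltr01.
Qed.

(** Otherwise some [e > 0] bounds from below all distances between continua without a common end.
    Chains with steps shorter than [e / 2] still cross, and a crossing brings points of two such
    continua closer than [e]. *)
Lemma k33_continua (A : nat -> nat -> set (R * R)) (u w : nat -> R * R) :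
  (forall i j, (i < 3)%N -> (j < 3)%N ->
     [/\ compact (A i j), connected (A i j), A i j (u i) & A i j (w j)]) ->
  exists i i' j j', [/\ [&& i < i', i' < 3, j < 3, j' < 3 & j != j']%N
     & A i j `&` A i' j' !=set0].
Proof.
move=> AP; apply: contrapT => noI.
have disj i i' j j' : [&& i < i', i' < 3, j < 3, j' < 3 & j != j']%N ->
    A i j `&` A i' j' = set0.
  move=> H; apply/eqP; rewrite -[_ == _]negbK; apply/negP => /set0P AI.
  by apply: noI; exists i, i', j, j'.
have distP (k : 'I_3 * 'I_3 * ('I_3 * 'I_3)) : exists d : R, 0 < d /\
    let: (i, i', (j, j')) := k in (i < i')%N -> j != j' ->
    forall x y, A i j x -> A i' j' y -> d <= `|x - y|.
  case: k => [[i i'] [j j']].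
  have [/andP[ii' jj']|H] := boolP ((i < i')%N && (j != j')); last first.
    by exists 1; split=> // h1 h2; case/negP: H; rewrite h1.
  have [|||d d0 dP] := @compact_disjoint_dist _ (A i j) (A i' j').
  - by case: (AP i j).
  - by case: (AP i' j').
  - by apply: disj; rewrite ii' !ltn_ord.
  by exists d.
have [d dP] := choice distP.
have [e e0 ed] := pos_lower_bound (fun k => (dP k).1).
have e20 : 0 < e / 2 by rewrite divr_gt0.
have chainP (ij : nat * nat) : exists s : seq (R * R),
    (ij.1 < 3)%N -> (ij.2 < 3)%N -> [/\ last (u ij.1) s = w ij.2,
      path (fun x y => `|x - y| < e / 2) (u ij.1) s
      & {in s, forall x, A ij.1 ij.2 x}].
  case: ij => i j /=; have [/andP[i3 j3]|H] := boolP ((i < 3)%N && (j < 3)%N).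
    have [_ cA Au Aw] := AP i j i3 j3.
    by have [s sP] := connected_chain e20 cA Au Aw; exists s.
  by exists [::] => h1 h2; case/negP: H; rewrite h1.
have [s sP] := choice chainP.
have sA i j x : (i < 3)%N -> (j < 3)%N -> x \in u i :: s (i, j) -> A i j x.
  move=> i3 j3; rewrite inE => /predU1P[->|]; first by case: (AP i j).
  by have [_ _] := sP (i, j) i3 j3; apply.
have neq i i' j j' x y : [&& i < i', i' < 3, j < 3, j' < 3 & j != j']%N ->
    A i j x -> A i' j' y -> x != y.
  move=> /disj AI Ax Ay; apply: contra_eqN AI => /eqP xy.
  by apply/set0P; exists x; split=> //; rewrite xy.
(* General position comes from disjointness: [w j'] lies on [A 0 j'], which misses [A 1 j]. *)
have neqw j j' x : (j < 3)%N -> (j' < 3)%N -> j != j' ->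
    x \in u 1%N :: s (1%N, j) -> w j' != x.
  move=> j3 j'3 jj' /(sA 1%N j)-/(_ isT j3) Ax.
  apply: (neq 0%N 1%N j' j) => //; first by rewrite j3 j'3 eq_sym jj'.
  by case: (AP 0%N j').
have [i [i' [j [j' [/and5P[ii' i'3 j3 j'3 jj'] cr]]]]] :
    exists i i' j j', [/\ [&& i < i', i' < 3, j < 3, j' < 3 & j != j']%N &
     cross left_of below (u i) (s (i, j)) (u i') (s (i', j'))].
  apply: (@k33_cross_odd _ _ _ u w (fun i j => s (i, j))).
  - by move=> i j i3 j3; case: (sP (i, j)).
  - move=> i j i3 j3 ij; apply: below_asym; apply: (neq 0%N 1%N j i) => //.
    + by rewrite i3 j3 eq_sym ij.
    + by case: (AP 0%N j).
    + by case: (AP 1%N i).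
  - by move=> j j' j3 j'3 jj' x xs; apply: left_of_asym; apply: neqw xs.
  - by move=> j j' j3 j'3 jj' x xs; apply: below_asym; apply: neqw xs.
have i3 : (i < 3)%N by apply: ltn_trans i'3.
have [_ pij _] := sP (i, j) i3 j3; have [_ pij' _] := sP (i', j') i'3 j'3.
have [x [x' [xs _ xx']]] := walk_sumP pij cr.
move=> /(walk_sumP pij')[y [y' [ys _ yy' /(step_cross_dist xx' yy')]]].
rewrite -splitr; apply/negP; rewrite -leNgt.
have := ed (Ordinal i3, Ordinal i'3, (Ordinal j3, Ordinal j'3)).
move=> /le_trans; apply; apply: (dP (_, _, (_, _))).2 => //; exact: sA.
Qed.

End Plane.

(** * Series-parallel graphs *)

Lemma ttsp_sub (T : finType) (V : {set T}) E s t :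
  ttsp V E s t -> forall e, e \in E -> #|e| = 2 /\ e \subset V.
Proof.
elim=> {V E s t} [s t st|V1 E1 V2 E2 s m t _ IH1 _ IH2 _|V1 E1 V2 E2 s t _ IH1 _ IH2 _ _] e.
- by rewrite inE => /eqP->; split=> //; rewrite cards2 st.
all: rewrite inE => /orP[/IH1|/IH2] [e2 eV]; split=> //;
  by rewrite (fintype.subset_trans eV) ?finset.subsetUl ?finset.subsetUr.
Qed.

(** A common edge would have its two ends in [V1 :&: V2], so it could only be [[set s; t]]. *)
Lemma ttsp_parallel_notin (T : finType) (V1 : {set T}) E1 V2 E2 s t :
  s != t -> ttsp V1 E1 s t -> ttsp V2 E2 s t -> (V1 :&: V2 = [set s; t])%SET ->
  [set s; t]%SET \notin E2 ->
  ttsp (V1 :|: V2)%SET (E1 :|: E2)%SET s t.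
Proof.
move=> st tt1 tt2 V12 stE2; apply: ttsp_parallel => //.
rewrite -setI_eq0; apply/eqP/setP => e; rewrite finset.in_set0; apply/negP.
rewrite inE => /andP[/(ttsp_sub tt1)[e2 eV1] eE2].
have [_ eV2] := ttsp_sub tt2 eE2.
case/negP: stE2; suff <- : e = [set s; t]%SET by [].
by apply/eqP; rewrite eqEcard -V12 finset.subsetI eV1 eV2 V12 e2 cards2 st.
Qed.

Local Open Scope classical_set_scope.

(** * Drawings and realizations *)

Section DrawingFacts.
Variables (R : realType) (V : finType).
Implicit Types (F : {set {set V}}) (D : drawing R V) (x y : V).

Lemma jordan_arc_continuum (p q : R * R) (A : set (R * R)) :
  jordan_arc p q A -> [/\ compact A, connected A, A p & A q].
Proof.
move=> [gamma [gc _ <- <- ->]]; split.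
- by apply: continuous_compact => //; exact: segment_compact.
- by apply: connected_continuous_connected => //; exact: segment_connected.
- by exists 0%R => //=; rewrite in_itv /= lexx ler01.
- by exists 1%R => //=; rewrite in_itv /= lexx ler01.
Qed.

Lemma planar_disjoint F D x y x' y' :
  planar F D -> [set x; y]%SET \in F -> [set x'; y']%SET \in F ->
  [&& x != x', x != y', y != x' & y != y'] ->
  arc_of D [set x; y]%SET `&` arc_of D [set x'; y']%SET = set0.
Proof.
move=> pl eF fF /and4P[n1 n2 n3 n4]; apply/eqP; rewrite -[_ == _]negbK; apply/negP.
move=> /set0P[p [pe pf]].
have ef : [set x; y]%SET != [set x'; y']%SET.
  by apply/eqP => /setP/(_ x); rewrite !inE eqxx (negbTE n1) (negbTE n2).
have [v + _] := pl _ _ eF fF ef p pe pf.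
rewrite !inE => /andP[/orP[]/eqP->];
  by rewrite ?(negbTE n1) ?(negbTE n2) ?(negbTE n3) ?(negbTE n4).
Qed.

(** The continuum [C] replaces the third vertex: its continuum towards [x j] is [C] with the arc
    from [o j] to [x j]. These three continua overlap in [C], which is harmless since they share an
    end. Any point of [C] can be that end; [o 0] is chosen. *)
Lemma k33_drawing (W : {set V}) F D (a b : V) (x o : nat -> V) (C : set (R * R)) :
  is_drawing W F D -> planar F D ->
  (forall i, (i < 3)%N -> [/\ [set a; x i]%SET \in F, [set b; x i]%SET \in F
     & [set x i; o i]%SET \in F]) ->
  (forall i j, (i < 3)%N -> (j < 3)%N -> i != j -> x i != x j) ->
  a != b ->
  (forall i j, (i < 3)%N -> (j < 3)%N ->
    [&& a != x i, b != x i, a != o i, b != o i & x i != o j]) ->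
  compact C -> connected C ->
  (forall i, (i < 3)%N -> [/\ C (point_of D (o i)),
     arc_of D [set a; x i]%SET `&` C = set0 & arc_of D [set b; x i]%SET `&` C = set0]) ->
  False.
Proof.
move=> [_ arcP] pl eF xx ab nabo cC conC CP.
pose A i j := match i with
  | 0 => arc_of D [set a; x j]%SET
  | 1 => arc_of D [set b; x j]%SET
  | _ => C `|` arc_of D [set x j; o j]%SET end.
have [i [i' [j [j' [/and5P[ii' i'3 j3 j'3 jj']]]]]] : exists i i' j j',
    [/\ [&& i < i', i' < 3, j < 3, j' < 3 & j != j']%N & A i j `&` A i' j' !=set0].
  pose u i := match i with 0 => point_of D a | 1 => point_of D b
              | _ => point_of D (o 0) end.
  apply: (@k33_continua R A u (fun j => point_of D (x j))) => i j i3 j3.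
  have [aF bF oF] := eF j j3.
  case: i i3 => [|[|i]] _ /=.
  - exact/jordan_arc_continuum/arcP.
  - exact/jordan_arc_continuum/arcP.
  have [c1 c2 c3 c4] := jordan_arc_continuum (arcP _ _ oF).
  have [Co _ _] := CP j j3; have [C0 _ _] := CP 0 isT.
  split.
  - exact: compactU.
  - by apply: connectedU => //; exists (point_of D (o j)).
  - by left.
  - by right.
have [ajF bjF ojF] := eF j j3; have [aF bF oF] := eF j' j'3.
have /and5P[ax bx _ _ xo] := nabo j j' j3 j'3.
have /and5P[ax' bx' ao' bo' _] := nabo j' j j'3 j3.
have xjj' := xx _ _ j3 j'3 jj'.
have [_ Ca Cb] := CP j j3.
move=> /set0P/negP; apply.
case: i i' ii' i'3 => [|[|i]] [|[|[|i']]] //= _ _.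
- by rewrite (planar_disjoint pl) ?ab ?ax' ?xjj' // eq_sym bx.
- by rewrite setIUr Ca (planar_disjoint pl) ?ax' ?ao' ?xjj' ?xo // setU0.
- by rewrite setIUr Cb (planar_disjoint pl) ?bx' ?bo' ?xjj' ?xo // setU0.
Qed.

End DrawingFacts.

Lemma card_inj_II (T : finType) (U : Type) (M : {set T}) (g : T -> U)
    (P : set U) (m : nat) :
  (P #= `I_m)%card -> {in M &, injective g} -> (forall z, z \in M -> P (g z)) ->
  (#|M| <= m)%N.
Proof.
move=> Pm ginj gP; have [->|[x0 _]] := set_0Vmem M; first by rewrite cards0.
pose f i := g (nth x0 (enum M) i).
have nM i : (i < #|M|)%N -> nth x0 (enum M) i \in M.
  by move=> iM; rewrite -mem_enum mem_nth // -cardE.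
have finj : {in `I_#|M| &, injective f}.
  move=> i j; rewrite !inE /= => iM jM /ginj /eqP.
  by rewrite !nM // nth_uniq ?enum_uniq -?cardE // => /(_ isT isT)/eqP.
rewrite -card_le_II -(card_le_eql (inj_card_eq finj)) -(card_le_eqr Pm).
by apply: subset_card_le => _ [i /= iM <-]; apply/gP/nM.
Qed.

(** * Persistence of points and arcs *)

Section Stability.
Variables (R : realType) (S : graph_story) (P : set (R * R)).
Variable Gamma : nat -> drawing R (story_graph S).
Hypothesis GammaP : realization P Gamma.

Lemma mem_window i x :
  (x \in window_vertices S i) =
  (maxn 1 (i.+1 - story_window S) <= story_rank x <= i)%N.
Proof. by rewrite inE. Qed.

Lemma window_between i j k x : (i <= j <= k)%N ->
  x \in window_vertices S i -> x \in window_vertices S k ->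
  x \in window_vertices S j.
Proof. rewrite !mem_window; lia. Qed.

Lemma window_edges_between i j k e : (i <= j <= k)%N ->
  e \in window_edges S i -> e \in window_edges S k -> e \in window_edges S j.
Proof.
move=> ijk; rewrite !inE => /andP[-> /fintype.subsetP ei] /andP[_ /fintype.subsetP ek].
by apply/fintype.subsetP => x xe; apply: window_between ijk _ _; [exact: ei|exact: ek].
Qed.

(** Condition (R2) only relates consecutive drawings, but the times at which [x] is alive form an
    interval, so the equalities chain up. *)
Lemma realization_point i j x : (0 < i <= j)%N -> (j <= #|story_graph S|)%N ->
  x \in window_vertices S i -> x \in window_vertices S j ->
  point_of (Gamma i) x = point_of (Gamma j) x.
Proof.
move=> /andP[i0]; elim: j => [|j IHj]; first by rewrite leqNgt i0.
rewrite leq_eqVlt => /predU1P[<-//|]; rewrite ltnS => ij jn xi xj1.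
have xj : x \in window_vertices S j by apply: window_between xi xj1; lia.
rewrite IHj //; last exact: ltnW.
have [|st _] := GammaP.2 j.+1; first by rewrite jn; lia.
by apply: st; rewrite inE /= xj xj1.
Qed.

Lemma realization_arc i j e : (0 < i <= j)%N -> (j <= #|story_graph S|)%N ->
  e \in window_edges S i -> e \in window_edges S j ->
  arc_of (Gamma i) e = arc_of (Gamma j) e.
Proof.
move=> /andP[i0]; elim: j => [|j IHj]; first by rewrite leqNgt i0.
rewrite leq_eqVlt => /predU1P[<-//|]; rewrite ltnS => ij jn ei ej1.
have ej : e \in window_edges S j by apply: window_edges_between ei ej1; lia.
rewrite IHj //; last exact: ltnW.
have [|_ st] := GammaP.2 j.+1; first by rewrite jn; lia.
by apply: st; rewrite finset.in_setI ej ej1.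
Qed.

End Stability.

(** * The story *)

Section Story.
Variables r t : nat.
(** There are [r] early and [r] middle vertices, two poles and [t] late vertices. *)
Let V := 'I_(r.*2 + t).+2.

(* In the notation of the introductory comment: o_i = [early i], x_i = [middle i],
   b = [pole1], a = [pole2], and the [late j] are the other vertices of the path.
   The vertices are numbered in the order of the story. *)
Definition vtx (i : nat) : V := inord i.

Lemma vtxK i : i < (r.*2 + t).+2 -> vtx i = i :> nat.
Proof. exact: inordK. Qed.

Lemma eq_vtx (z : V) i : i < (r.*2 + t).+2 -> (z == vtx i) = (z == i :> nat).
Proof. by move=> /vtxK {2}<-. Qed.

Definition pole1 := vtx r.*2.
Definition pole2 := vtx r.*2.+1.
Definition early i := vtx i.
Definition middle i := vtx (r + i).
Definition late j := vtx (r.*2 + j).+2.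

Definition edge (x y : V) : {set {set V}} := [set [set x; y]]%SET.

(** The unions are nested as in the series-parallel derivation: an edge in series with a triangle,
    which is an edge in parallel with a path of length two. *)
Definition branch_edges i : {set {set V}} :=
  (edge pole1 (middle i) :|:
    (edge (middle i) pole2 :|: (edge (middle i) (early i) :|: edge (early i) pole2)))%SET.

Definition fan_edges m := (\bigcup_(i < m) branch_edges i)%SET.

(** The vertex before [late j] is [pole2] when [j = 0], and [late j.-1] otherwise. *)
Definition path_edges m :=
  (\bigcup_(j < m) edge (vtx (r.*2 + j).+1) (late j))%SET.

Definition story_edges := (fan_edges r :|: path_edges t)%SET.

Definition branch_vertices i : {set V} :=
  ([set pole1; middle i] :|:
    ([set middle i; pole2] :|: ([set middle i; early i] :|: [set early i; pole2])))%SET.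

(** The description by ranks makes the unions in the derivation a matter of linear arithmetic. *)
Definition fan_vertices m : {set V} :=
  [set z : V | [|| z < m, r <= z < r + m | r.*2 <= z <= r.*2.+1]]%SET.

Definition path_vertices m : {set V} :=
  [set z : V | r.*2 < z <= (r.*2 + m).+1]%SET.

Ltac vtx_lia := rewrite /pole1 /pole2 /early /middle /late ?inE ?eq_vtx ?vtxK; lia.

Lemma branch_ttsp i : i < r -> ttsp (branch_vertices i) (branch_edges i) pole1 pole2.
Proof.
move=> ir; apply: (@ttsp_series _ _ _ _ _ _ (middle i)).
- by apply: ttsp_edge; vtx_lia.
- apply: ttsp_parallel_notin.
  + vtx_lia.
  + by apply: ttsp_edge; vtx_lia.
  + apply: (@ttsp_series _ _ _ _ _ _ (early i)).
    * by apply: ttsp_edge; vtx_lia.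
    * by apply: ttsp_edge; vtx_lia.
    * by apply/setP => z; vtx_lia.
  + by apply/setP => z; vtx_lia.
  + rewrite !inE; apply/negP => /orP[]/eqP/setP.
      by move=> /(_ (early i)); vtx_lia.
    by move=> /(_ (middle i)); vtx_lia.
- by apply/setP => z; vtx_lia.
Qed.

Lemma fan_ttsp m : m < r -> ttsp (fan_vertices m.+1) (fan_edges m.+1) pole1 pole2.
Proof.
elim: m => [|m IHm] mr.
  rewrite /fan_edges big_ord1.
  suff -> : fan_vertices 1 = branch_vertices 0 by exact: branch_ttsp.
  by apply/setP => z; vtx_lia.
rewrite /fan_edges big_ord_recr /=.
suff -> : fan_vertices m.+2 = (fan_vertices m.+1 :|: branch_vertices m.+1)%SET.
  apply: ttsp_parallel_notin.
  - vtx_lia.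
  - exact/IHm/ltnW.
  - exact: branch_ttsp.
  - by apply/setP => z; vtx_lia.
  rewrite !inE; apply/negP => /orP[|/orP[|/orP[]]]/eqP/setP.
  - by move=> /(_ (middle m.+1)); vtx_lia.
  - by move=> /(_ (middle m.+1)); vtx_lia.
  - by move=> /(_ (middle m.+1)); vtx_lia.
  - by move=> /(_ (early m.+1)); vtx_lia.
by apply/setP => z; vtx_lia.
Qed.

Lemma path_ttsp m : m < t -> ttsp (path_vertices m.+1) (path_edges m.+1) pole2 (late m).
Proof.
elim: m => [|m IHm] mt.
  rewrite /path_edges big_ord1.
  suff -> : path_vertices 1 = [set pole2; late 0]%SET.
    by rewrite addn0; apply: ttsp_edge; vtx_lia.
  by apply/setP => z; vtx_lia.
rewrite /path_edges big_ord_recr /=.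
suff -> : path_vertices m.+2 = (path_vertices m.+1 :|: [set late m; late m.+1])%SET.
  apply: (@ttsp_series _ _ _ _ _ _ (late m)).
  - exact/IHm/ltnW.
  - by rewrite addnS; apply: ttsp_edge; vtx_lia.
  by apply/setP => z; vtx_lia.
by apply/setP => z; vtx_lia.
Qed.

(** The parallel composition of the branches is followed at [pole2] by the path in series. *)
Lemma story_ttsp : 0 < r -> 0 < t ->
  ttsp [set: V]%SET story_edges pole1 (late t.-1).
Proof.
move=> r0 t0.
suff -> : [set: V]%SET = (fan_vertices r.-1.+1 :|: path_vertices t.-1.+1)%SET.
  have -> : story_edges = (fan_edges r.-1.+1 :|: path_edges t.-1.+1)%SET by rewrite !prednK.
  apply: (@ttsp_series _ _ _ _ _ _ pole2).
  - by apply: fan_ttsp; rewrite prednK.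
  - by apply: path_ttsp; rewrite prednK.
  by apply/setP => z; vtx_lia.
by apply/setP => z; have := ltn_ord z; vtx_lia.
Qed.

Hypotheses (r_gt0 : (0 < r)%N) (le_rt : (r <= t)%N).
(** This is the number of middle vertices, poles and late vertices together, which thus fill the
    last window. As [r <= t], a window can also hold all early and middle vertices and the poles. *)
Let omega := (r + t).+2.
Let n := (r.*2 + t).+2.

Lemma story_edges_card2 e : e \in story_edges -> #|e| = 2.
Proof. by case/(ttsp_sub (story_ttsp r_gt0 (leq_trans r_gt0 le_rt))). Qed.

Definition fan_graph := Graph story_edges_card2.

Definition fan_order : #|fan_graph|.-tuple fan_graph := enum_tuple fan_graph.

Lemma series_parallel_story : series_parallel fan_graph.
Proof. by exists pole1, (late t.-1); exact: story_ttsp r_gt0 (leq_trans r_gt0 le_rt). Qed.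

Lemma card_story : #|fan_graph| = n.
Proof. by rewrite card_ord. Qed.

Lemma pole1_middle_edge i : (i < r)%N -> [set pole1; middle i]%SET \in story_edges.
Proof.
move=> ir; rewrite inE; apply/orP; left; apply/bigcupP.
by exists (Ordinal ir) => //; rewrite !inE eqxx.
Qed.

Lemma pole2_middle_edge i : (i < r)%N -> [set pole2; middle i]%SET \in story_edges.
Proof.
move=> ir; rewrite inE; apply/orP; left; apply/bigcupP.
by exists (Ordinal ir) => //; rewrite !inE finset.setUC eqxx orbT.
Qed.

Lemma middle_early_edge i : (i < r)%N -> [set middle i; early i]%SET \in story_edges.
Proof.
move=> ir; rewrite inE; apply/orP; left; apply/bigcupP.
by exists (Ordinal ir) => //; rewrite !inE eqxx !orbT.
Qed.

Lemma late_late_edge j : (j.+1 < t)%N -> [set late j; late j.+1]%SET \in story_edges.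
Proof.
move=> jt; rewrite inE; apply/orP; right; apply/bigcupP.
by exists (Ordinal jt) => //; rewrite !inE /= addnS eqxx.
Qed.

(** The longest edge joins [early 0] to [pole2]; its span [r.*2.+1] is less than [omega] because
    [r <= t]. *)
Lemma story_edge_span e (x y : V) :
  e \in story_edges -> x \in e -> y \in e -> (x < y + omega)%N.
Proof.
suff H i j : (i < n)%N -> (j < n)%N -> (i < j + omega)%N -> (j < i + omega)%N ->
    x \in [set vtx i; vtx j]%SET -> y \in [set vtx i; vtx j]%SET -> (x < y + omega)%N.
  rewrite inE => /orP[]/bigcupP[[i ilt] _]; rewrite !inE /=.
    case/orP=> [|/orP[|/orP[]]] /eqP->; apply: H; rewrite /n /omega; lia.
  by move=> /eqP->; apply: H; rewrite /n /omega; lia.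
by move=> iN jN ij ji; rewrite !inE !eq_vtx //; lia.
Qed.

Section Extra.
Variable k : nat.
Let S := GraphStory omega k fan_order.

Lemma story_rankE (x : story_graph S) : story_rank x = (x : V).+1.
Proof. by rewrite /story_rank /= index_enum_ord. Qed.

Lemma story_is_graph_story : is_graph_story S.
Proof.
split.
- by rewrite card_story /= /omega /n; lia.
- exact: enum_uniq.
move=> x y xy; rewrite !story_rankE addSn ltnS.
by apply: (story_edge_span xy); rewrite !inE eqxx ?orbT.
Qed.

Lemma mem_windowE i (x : story_graph S) :
  (x \in window_vertices S i) = (i < (x : V).+1 + omega)%N && ((x : V) < i)%N.
Proof. by rewrite mem_window story_rankE /=; lia. Qed.

Lemma mem_window_edges i (x y : story_graph S) : [set x; y]%SET \in story_edges ->
  x \in window_vertices S i -> y \in window_vertices S i ->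
  [set x; y]%SET \in window_edges S i.
Proof.
move=> xy xi yi; rewrite inE xy /=; apply/fintype.subsetP => z.
by rewrite !inE => /orP[]/eqP->; [move: xi|move: yi]; rewrite inE.
Qed.

(** * Reused points and the final count *)

Section Realization.
Variables (R : realType) (P : set (R * R)) (Gamma : nat -> drawing R (story_graph S)).
Hypothesis GammaP : realization P Gamma.
(** Only two times matter: at the first, exactly the early and middle vertices and the poles are
    alive; at the second, [n], exactly the vertices that are not early. *)
Let D1 := Gamma r.*2.+2.
Let D2 := Gamma n.

Lemma realized i : (0 < i <= n)%N ->
  [/\ is_drawing (window_vertices S i) (window_edges S i) (Gamma i),
      planar (window_edges S i) (Gamma i)
    & forall x, x \in window_vertices S i -> P (point_of (Gamma i) x)].
Proof. by move=> i_n; apply: GammaP.1; rewrite card_story. Qed.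

Lemma first_window (z : story_graph S) : ((z : V) < r.*2.+2)%N -> z \in window_vertices S r.*2.+2.
Proof. by rewrite mem_windowE /omega => ->; lia. Qed.

Lemma last_window (z : story_graph S) : (r <= (z : V))%N -> z \in window_vertices S n.
Proof. by rewrite mem_windowE /omega /n => rz; rewrite ltn_ord; lia. Qed.

Lemma core_point (z : story_graph S) : (r <= (z : V) < r.*2.+2)%N ->
  point_of D1 z = point_of D2 z.
Proof.
case/andP=> rz zr; apply: (realization_point GammaP).
- by rewrite /n; lia.
- by rewrite card_story.
- exact: first_window.
- exact: last_window.
Qed.

Lemma core_arc (x y : story_graph S) : [set x; y]%SET \in story_edges ->
  (r <= (x : V) < r.*2.+2)%N -> (r <= (y : V) < r.*2.+2)%N ->
  arc_of D1 [set x; y]%SET = arc_of D2 [set x; y]%SET.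
Proof.
move=> xy /andP[rx xr] /andP[ry yr]; apply: (realization_arc GammaP).
- by rewrite /n; lia.
- by rewrite card_story.
- by apply: mem_window_edges => //; exact: first_window.
- by apply: mem_window_edges => //; exact: last_window.
Qed.

(** The continuum is the union of the arcs from [late 0] to [late m.+1]. The edge from [pole2] to
    [late 0] is left out, so that no arc used has an end at a pole. *)
Lemma late_continuum m : (m.+1 < t)%N -> exists C : set (R * R),
  [/\ compact C, connected C,
     forall j, (j <= m.+1)%N -> C (point_of D2 (late j))
   & forall p, C p -> exists2 j, (j <= m)%N & arc_of D2 [set late j; late j.+1]%SET p].
Proof.
have D2P : is_drawing (window_vertices S n) (window_edges S n) D2.
  by case: (@realized n) => //; rewrite leqnn.
have arcC j : (j.+1 < t)%N -> [/\ compact (arc_of D2 [set late j; late j.+1]%SET),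
    connected (arc_of D2 [set late j; late j.+1]%SET),
    arc_of D2 [set late j; late j.+1]%SET (point_of D2 (late j))
    & arc_of D2 [set late j; late j.+1]%SET (point_of D2 (late j.+1))].
  move=> jt; apply/jordan_arc_continuum/D2P.2/mem_window_edges.
  - exact: late_late_edge.
  - by apply: last_window; vtx_lia.
  - by apply: last_window; vtx_lia.
elim: m => [|m IHm] mt.
  have [c1 c2 c3 c4] := arcC _ mt.
  exists (arc_of D2 [set late 0; late 1]%SET); split=> //; last by exists 0.
  by case=> [|[|j]].
have [C [cC conC Clate Carc]] := IHm (ltnW mt).
have [c1 c2 c3 c4] := arcC _ mt.
exists (C `|` arc_of D2 [set late m.+1; late m.+2]%SET); split.
- exact: compactU.
- by apply: connectedU => //; exists (point_of D2 (late m.+1)); split => //; exact: Clate.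
- move=> j; rewrite leq_eqVlt => /predU1P[->|jm]; first by right.
  by left; apply: Clate.
- by move=> p [/Carc[j jm pj]|pj]; [exists j => //; exact: leqW|exists m.+1].
Qed.

(** The graph $K_{3,3}$ is found in [D1], while [C] comes from [D2]. The arcs from the poles to the
    middle vertices are the same in both, so planarity of [D2] keeps [C] away from them. The arcs to
    early vertices are absent from [D2] and may meet [C]. *)
Lemma reused_points (i j : nat -> nat) :
  (forall l, (l < 3)%N -> [/\ (i l < r)%N, (j l < t)%N
     & point_of D2 (late (j l)) = point_of D1 (early (i l))]) ->
  (forall l l', (l < 3)%N -> (l' < 3)%N -> l != l' -> i l != i l') -> False.
Proof.
move=> ijP i_inj.
have r3 : (3 <= r)%N.
  have [i0r _ _] := ijP 0 isT; have [i1r _ _] := ijP 1 isT; have [i2r _ _] := ijP 2 isT.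
  have := (i_inj 0 1 isT isT isT, i_inj 0 2 isT isT isT, i_inj 1 2 isT isT isT).
  by case=> [[]]; lia.
(* As [t >= r >= 3], the index [t.-2] covers the path up to its last vertex [late t.-1]. *)
have [|C [cC conC Clate Carc]] := @late_continuum t.-2; first by lia.
have [D1P D1pl _] : [/\ is_drawing (window_vertices S r.*2.+2) (window_edges S r.*2.+2) D1,
    planar (window_edges S r.*2.+2) D1
   & forall x, x \in window_vertices S r.*2.+2 -> P (point_of D1 x)].
  by apply: realized; rewrite /n; lia.
have [_ D2pl _] : [/\ is_drawing (window_vertices S n) (window_edges S n) D2,
    planar (window_edges S n) D2
   & forall x, x \in window_vertices S n -> P (point_of D2 x)].
  by apply: realized; rewrite /n; lia.
have Cdisj a x : [set a; x]%SET \in story_edges ->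
    (r <= (a : V) < r.*2.+2)%N -> (r <= (x : V) < r.*2.+2)%N ->
    arc_of D1 [set a; x]%SET `&` C = set0.
  move=> ax ra rx; rewrite core_arc //; apply/eqP; rewrite -[_ == _]negbK; apply/negP.
  move=> /set0P[p [pax /Carc[l lt_ pl]]].
  have lt : (l.+1 < t)%N by lia.
  have : (arc_of D2 [set a; x]%SET `&` arc_of D2 [set late l; late l.+1]%SET) p by [].
  rewrite (planar_disjoint D2pl) //.
  - by apply: mem_window_edges => //; apply: last_window; lia.
  - by apply: mem_window_edges; [exact: late_late_edge| |]; apply: last_window; vtx_lia.
  - by vtx_lia.
have D1e x y : [set x; y]%SET \in story_edges -> ((x : V) < r.*2.+2)%N ->
    ((y : V) < r.*2.+2)%N -> [set x; y]%SET \in window_edges S r.*2.+2.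
  by move=> xy x2 y2; apply: mem_window_edges => //; exact: first_window.
have ir l : (l < 3)%N -> (i l < r)%N by move=> /ijP[].
apply: (@k33_drawing _ _ _ _ _ pole1 pole2 (middle \o i) (early \o i) C D1P D1pl) => //=.
- move=> l /ir lr; split; apply: D1e; try vtx_lia.
  + exact: pole1_middle_edge.
  + exact: pole2_middle_edge.
  + exact: middle_early_edge.
- by move=> l l' l3 l'3 /(i_inj _ _ l3 l'3); move: (ir _ l3) (ir _ l'3) => lr l'r ll'; vtx_lia.
- by vtx_lia.
- by move=> l l' /ir lr /ir l'r; vtx_lia.
- move=> l l3; have [lr jt ij] := ijP _ l3; split.
  + by rewrite -ij; apply: Clate; lia.
  + by apply: Cdisj; [exact: pole1_middle_edge| |]; vtx_lia.
  + by apply: Cdisj; [exact: pole2_middle_edge| |]; vtx_lia.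
Qed.

Lemma lateK (z : V) : (r.*2.+2 <= z)%N -> late (z - r.*2.+2) = z.
Proof. by move=> rz; have zn := ltn_ord z; apply: val_inj; rewrite /= vtxK; lia. Qed.

Lemma late_index (z : V) : (r.*2.+2 <= z)%N -> (z - r.*2.+2 < t)%N.
Proof. by move=> rz; have zn := ltn_ord z; lia. Qed.

Definition reusing : {set V} :=
  [set z : V | `[< (r.*2.+2 <= z)%N /\
     exists2 i, (i < r)%N & point_of D2 z = point_of D1 (early i) >]]%SET.

(** Injectivity of [D2] makes three reusing vertices occupy the points of three distinct early
    vertices. *)
Lemma card_reusing : (#|reusing| <= 2)%N.
Proof.
rewrite leqNgt; apply/negP => /card_gt2P[x [y [z [[xB yB zB] [xy yz zx]]]]].
pose s := [:: x; y; z].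
have sB l : (l < 3)%N -> nth x s l \in reusing by case: l => [|[|[|]]].
have s_inj l l' : (l < 3)%N -> (l' < 3)%N -> l != l' -> nth x s l != nth x s l'.
  by move=> l3 l'3; rewrite nth_uniq //= !inE negb_or xy yz eq_sym zx.
have iP l : exists i, (l < 3)%N -> (i < r)%N /\ point_of D2 (nth x s l) = point_of D1 (early i).
  case: (ltnP l 3) => [/sB|_]; last by exists 0.
  by rewrite inE => /asboolP[_ [i ir ei]]; exists i.
have [i iE] := choice iP.
apply: (@reused_points i (fun l => nth x s l - r.*2.+2)).
  move=> l l3; have [ir ei] := iE l l3.
  have := sB l l3; rewrite inE => /asboolP[rz _].
  split=> //; first exact: late_index.
  by rewrite lateK.
move=> l l' l3 l'3 /(s_inj _ _ l3 l'3); apply: contra_neqN => /eqP ii.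
have [_ el] := iE l l3; have [_ el'] := iE l' l'3.
have [|[D2inj _] _ _] := @realized n; first by rewrite leqnn.
apply: D2inj; last by rewrite el el' ii.
  by apply: last_window; have := sB l l3; rewrite inE => /asboolP[rz _]; lia.
by apply: last_window; have := sB l' l'3; rewrite inE => /asboolP[rz _]; lia.
Qed.

(** All vertices but the at most two reusing ones get distinct points of [P], so
    [n - 2 <= omega + k], where [n - omega = r]. *)
Lemma card_points : (P #= `I_(omega + k))%card -> (r <= k + 2)%N.
Proof.
move=> Pcard.
have [|[D1inj _] _ D1P] := @realized r.*2.+2; first by rewrite /n; lia.
have [|[D2inj _] _ D2P] := @realized n; first by rewrite leqnn.
pose g (z : V) := if (z < r.*2.+2)%N then point_of D1 z else point_of D2 z.
have cardM : (#|~: reusing| <= omega + k)%N.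
  apply: (card_inj_II (g := g) Pcard); last first.
    move=> z _; rewrite /g; case: ltnP => zr; first exact/D1P/first_window.
    by apply/D2P/last_window; lia.
  (* If [z] is early, the equality makes [z'] reusing; otherwise [z] has the same point in [D2],
     where points are distinct. *)
  have g_new (z z' : V) : z' \notin reusing -> (z < r.*2.+2)%N -> (r.*2.+2 <= z')%N ->
      point_of D1 z = point_of D2 z' -> z = z'.
    move=> z'R zr z'r zz'; case: (ltnP z r) => rz.
      case/negP: z'R; rewrite inE; apply/asboolP; split=> //; exists z => //.
      by rewrite -zz'; congr point_of; apply: val_inj; rewrite /= vtxK.
    apply: D2inj; [exact: last_window|apply: last_window; lia|].
    by rewrite -core_point // rz.
  move=> z z'; rewrite !finset.in_setC /g => zR z'R.
  case: (ltnP z) => zr; case: (ltnP z') => z'r.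
  - by apply: D1inj; exact: first_window.
  - exact: g_new.
  - by move=> /esym/g_new => /(_ zR z'r zr).
  - by apply: D2inj; apply: last_window; lia.
have := cardsC reusing; rewrite card_ord; have := card_reusing; move: cardM.
by rewrite /omega; lia.
Qed.

End Realization.
End Extra.
End Story.

Theorem theorem7 (R : realType) (omega : nat) (homega : (8 <= omega)%N) :
  exists (G : graph) (tau : #|G|.-tuple G),
    series_parallel G /\
    forall k : nat, (k < omega./2 - 3)%N ->
      is_graph_story (GraphStory omega k tau) /\
      ~ realizable R (GraphStory omega k tau).
Proof.
have [r [t [r0 rt tr ->]]] : exists r t,
    [/\ (0 < r)%N, (r <= t)%N, (t <= r.+1)%N & omega = (r + t).+2].
  (* Here [t] is [r] or [r.+1] according to the parity of [omega], so [omega./2 = r.+1] and the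
     assumption on [k] reads [k + 2 < r]. *)
  by exists omega./2.-1, (omega - omega./2.+1); split; lia.
exists (fan_graph r0 rt), (fan_order r0 rt); split; first exact: series_parallel_story.
move=> k k_lt; split; first exact: story_is_graph_story.
by move=> [P Pcard [Gamma /card_points/(_ Pcard)]]; lia.
Qed.
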